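(* Let $\mathbb{K}\in\{\mathbb{R},\mathbb{C}\}$ and let $H \in \mathbb{K}^{n\times n}$ be a nonsingular selfadjoint matrix. Then any nonsingular matrix $F \in \mathbb{K}^{n \times n}$ can be factorized (non-uniquely) as $$F = L X S= S' L_1 X_1= S' X' L' =X'_1 L'_1 S,$$ where, with $\Sigma= \mathrm{Sign}(F^{[H]}F)$ and $\Sigma'= \mathrm{Sign}(FF^{[H]})$, $$S=(\Sigma F^{[H]}F)^{1/2}\in \mathbb{K}^{n \times n}$$ is $r$-positive-definite, $H$-selfadjoint and $H\Sigma$-selfadjoint, $$S'=(\Sigma' FF^{[H]})^{1/2} \in \mathbb{K}^{n\times n}$$ is $r$-positive-definite, $H$-selfadjoint and $H\Sigma'$-selfadjoint, the matrices $L, L_1, L', L'_1\in \mathbb{K}^{n \times n}$ are $H$-unitary, the matrices $X, X_1, X', X'_1\in \mathbb{K}^{n \times n}$ are $H$-normal $H$-neutral involutory, and $$LX=L_1X_1= X' L'=X_1' L_1'.$$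
   Context: For a matrix $A$ over $\mathbb{K}$, $A^\dagger$ denotes the conjugate transpose if $\mathbb{K}=\mathbb{C}$ and the transpose if $\mathbb{K}=\mathbb{R}$; $A$ is selfadjoint if $A^\dagger=A$. For a nonsingular selfadjoint $H\in\mathbb{K}^{n\times n}$ put $[x,y]_H=x^\dagger H y$ for $x,y\in\mathbb{K}^n$, and $A^{[H]}=H^{-1}A^\dagger H$ for $A\in\mathbb{K}^{n\times n}$ (the $H$-adjoint). For a nonsingular selfadjoint $M$ (e.g. $M=H$, $H\Sigma$, $H\Sigma'$), a matrix $A$ is $M$-selfadjoint if $A^{[M]}=A$, i.e. $A^\dagger M=MA$. A matrix $A$ is $H$-unitary if $A^{[H]}A=AA^{[H]}=I_n$, and $H$-normal if $AA^{[H]}=A^{[H]}A$. A matrix is $r$-positive-definite if all its eigenvalues have positive real part. For a nonsingular $A$ with no negative real eigenvalues, $A^{1/2}$ is the principal square root, i.e. the unique $r$-positive-definite solution $Y$ of $Y^2=A$. Sign function: for $\lambda\in\mathbb{C}\setminus\{0\}$, $\mathrm{Sign}(\lambda)=-1$ if $\lambda$ is a negative real number and $\mathrm{Sign}(\lambda)=+1$ otherwise, with all derivatives of order $\ge 1$ declared to be zero at every $\lambda\ne 0$. For a nonsingular $A\in\mathbb{K}^{n\times n}$, $\mathrm{Sign}(A)$ is the corresponding primary matrix function; equivalently, $\mathrm{Sign}(A)$ is the linear map acting as $-1$ on the span of all generalized eigenvectors of $A$ for negative real eigenvalues and as $+1$ on the span of all generalized eigenvectors for all other eigenvalues (it is real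 if $A$ is real). A matrix $X\in\mathbb{K}^{n\times n}$ is involutory if $X^2=I_n$. A subspace $\mathcal{N}\subseteq\mathbb{K}^n$ is $H$-neutral if $[u,v]_H=0$ for all $u,v\in\mathcal{N}$. An involutory $X$ is $H$-neutral if its negative eigenspace $\{v\in\mathbb{K}^n: Xv=-v\}$ is $H$-neutral or $\{0\}$. $X$ is $H$-normal $H$-neutral involutory if it is involutory, $H$-neutral and $H$-normal. *)

(* Defs.v *)
From HB Require Import structures.
From mathcomp Require Import all_boot all_order all_algebra.
From mathcomp Require Import boolp classical_sets reals complex.

Set Implicit Arguments.
Unset Strict Implicit.
Unset Printing Implicit Defensive.

Import Order.TTheory GRing.Theory Num.Theory.
Local Open Scope ring_scope.

(* The ground field K is R or C = R[i], chosen by an element of [ground]. *)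
Variant ground := RealGround | ComplexGround.

Definition base (R : realType) (k : ground) : fieldType :=
  match k with RealGround => R : fieldType | ComplexGround => R[i] : fieldType end.

Definition base_conj (R : realType) (k : ground) : base R k -> base R k :=
  match k return base R k -> base R k with
  | RealGround => id
  | ComplexGround => @conjc R
  end.

Definition base_emb (R : realType) (k : ground) : base R k -> R[i] :=
  match k return base R k -> R[i] with
  | RealGround => real_complex R
  | ComplexGround => id
  end.

Fact base_conj_zmod (R : realType) (k : ground) :
  zmod_morphism (@base_conj R k).
Proof. by case: k => // x y; exact: rmorphB. Qed.

Fact base_conj_monoid (R : realType) (k : ground) :
  monoid_morphism (@base_conj R k).
Proof. by case: k => //; split=> [|x y]; [exact: rmorph1|exact: rmorphM]. Qed.

HB.instance Definition _ (R : realType) (k : ground) :=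
  GRing.isZmodMorphism.Build _ _ (@base_conj R k) (@base_conj_zmod R k).
HB.instance Definition _ (R : realType) (k : ground) :=
  GRing.isMonoidMorphism.Build _ _ (@base_conj R k) (@base_conj_monoid R k).

Fact base_emb_zmod (R : realType) (k : ground) :
  zmod_morphism (@base_emb R k).
Proof. by case: k => // x y; exact: rmorphB. Qed.

Fact base_emb_monoid (R : realType) (k : ground) :
  monoid_morphism (@base_emb R k).
Proof. by case: k => //; split=> [|x y]; [exact: rmorph1|exact: rmorphM]. Qed.

HB.instance Definition _ (R : realType) (k : ground) :=
  GRing.isZmodMorphism.Build _ _ (@base_emb R k) (@base_emb_zmod R k).
HB.instance Definition _ (R : realType) (k : ground) :=
  GRing.isMonoidMorphism.Build _ _ (@base_emb R k) (@base_emb_monoid R k).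

Section Matrices.
Variables (R : realType) (k : ground).
Local Notation K := (base R k).

Definition dagger m n (A : 'M[K]_(m, n)) : 'M[K]_(n, m) :=
  map_mx (@base_conj R k) A^T.

Definition to_complex m n (A : 'M[K]_(m, n)) : 'M[R[i]]_(m, n) :=
  map_mx (@base_emb R k) A.

Definition selfadjoint n (A : 'M[K]_n) : Prop := dagger A = A.

Definition iprod n (H : 'M[K]_n) (x y : 'cV[K]_n) : K :=
  (dagger x *m H *m y) 0 0.

(* The M-adjoint A^[M]; it is meaningful for nonsingular selfadjoint M. *)
Definition adj n (M A : 'M[K]_n) : 'M[K]_n := invmx M *m dagger A *m M.

Definition M_selfadjoint n (M A : 'M[K]_n) : Prop := adj M A = A.

Definition H_unitary n (H A : 'M[K]_n) : Prop :=
  adj H A *m A = 1%:M /\ A *m adj H A = 1%:M.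

Definition H_normal n (H A : 'M[K]_n) : Prop :=
  A *m adj H A = adj H A *m A.

(* Eigenvalues are complex, also for K = R. *)
Definition r_positive_definite n (A : 'M[K]_n) : Prop :=
  forall z : R[i], eigenvalue (to_complex A) z -> 0 < complex.Re z.

Definition is_principal_sqrt n (A Y : 'M[K]_n) : Prop :=
  r_positive_definite Y /\ Y *m Y = A.

(* A^(1/2), the element Y of K^(n x n) such that is_principal_sqrt A Y, which is
   unique by principal_sqrt_unique below; 0 if there is none. *)
Definition principal_sqrt n (A : 'M[K]_n) : 'M[K]_n :=
  xget 0 [set Y | is_principal_sqrt A Y]%classic.

(* A scalar function together with its declared derivatives: f j z is the value
   of the j-th derivative at z.  The primary matrix function f(A) is p(A) for
   any polynomial p that agrees with f on the spectrum of A in the Hermite sense,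
   i.e. p^(j)(z) = f j z for every j smaller than the multiplicity of z as a root
   of the minimal polynomial of A (the size of the largest Jordan block of A for
   z). *)
Definition is_primary_function n (f : nat -> R[i] -> R[i]) (A B : 'M[K]_n.+1) :
    Prop :=
  exists p : {poly R[i]},
    (forall (z : R[i]) (j : nat), (j < mup z (mxminpoly (to_complex A)))%N ->
       p^`(j).[z] = f j z) /\
    to_complex B = horner_mx (to_complex A) p.

(* In the partial order of R[i], z < 0 means that z is a negative real number. *)
Definition sign_fun (j : nat) (z : R[i]) : R[i] :=
  if j is 0%N then (if z < 0 then -1 else 1) else 0.

(* Unique by primary_function_unique below; 0 if there is none. *)
Definition Sign n (A : 'M[K]_n.+1) : 'M[K]_n.+1 :=
  xget 0 [set B | is_primary_function sign_fun A B]%classic.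

Definition involutory n (X : 'M[K]_n) : Prop := X *m X = 1%:M.

Definition neutral n (H : 'M[K]_n) (N : set 'cV[K]_n) : Prop :=
  forall u v, N u -> N v -> iprod H u v = 0.

Definition neg_eigenspace n (X : 'M[K]_n) : set 'cV[K]_n :=
  [set v | X *m v = - v]%classic.

(* The case of a zero negative eigenspace is included: {0} is neutral. *)
Definition H_neutral_involutory n (H X : 'M[K]_n) : Prop :=
  involutory X /\ neutral H (neg_eigenspace X).

Definition H_normal_neutral_involutory n (H X : 'M[K]_n) : Prop :=
  H_neutral_involutory H X /\ H_normal H X.

End Matrices.

Section WellDefined.
Variable R : realType.
Local Notation C := R[i].

Let dvdp_derivn (d : {poly C}) (z : C) (m : nat) :
  (forall j, (j < m)%N -> d^`(j).[z] = 0) -> ('X - z%:P) ^+ m %| d.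
Proof.
elim: m d => [|m IHm] d dm; first by rewrite expr0 dvd1p.
have {}IHm : ('X - z%:P) ^+ m %| d^`().
  by apply: IHm => j jm; rewrite -derivSn dm.
have dz : root d z by apply/eqP; rewrite -[d]derivn0 dm.
have [->|d0] := eqVneq d 0; first exact: dvdp0.
have [k [e]] := multiplicity_XsubC d z; rewrite d0 /= => ez dE.
have [mk|km] := ltnP m k.
  by rewrite dE dvdp_mull// dvdp_exp2l.
case: k dE km => [|k] dE km.
  by move: dz; rewrite dE expr0 mulr1 (negbTE ez).
have dE' : d^`() = ('X - z%:P) ^+ k * (e^`() * ('X - z%:P) + e *+ k.+1).
  rewrite dE derivM deriv_exp derivXsubC mul1r /= mulrDr !mulrnAr.
  by rewrite exprSr [e * _]mulrC mulrCA.

have : ('X - z%:P) ^+ k.+1 %| d^`() by apply: dvdp_trans IHm; exact: dvdp_exp2l.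
rewrite dE' exprSr dvdp_mul2l ?expf_neq0 ?polyXsubC_eq0//.
rewrite -root_factor_theorem /root hornerD hornerM hornerXsubC subrr mulr0 add0r.
by rewrite hornerMn mulrn_eq0 /= -[_ == 0]/(root e z) (negbTE ez).
Qed.

Let dvdp_mup (s : seq C) (d : {poly C}) :
  (forall z, ('X - z%:P) ^+ (count_mem z s) %| d) ->
  \prod_(z <- s) ('X - z%:P) %| d.
Proof.
elim: s d => [|y s IHs] d sd; first by rewrite big_nil dvd1p.
have [->|d0] := eqVneq d 0; first exact: dvdp0.
have /dvdpP[e dE] : 'X - y%:P %| d.
  by apply: dvdp_trans (sd y); rewrite /= eqxx exprS dvdp_mulr.
rewrite big_cons dE mulrC dvdp_mul2r ?polyXsubC_eq0//; apply: IHs => z.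
have := sd z; rewrite dE /=; have [<-|yz] := eqVneq y z.
  by rewrite exprSr dvdp_mul2r ?polyXsubC_eq0.
by rewrite add0n Gauss_dvdpl// coprimep_expl// coprimep_XsubC root_XsubC.
Qed.

Lemma primary_function_unique (k : ground) n (f : nat -> C -> C)
    (A B B' : 'M[base R k]_n.+1) :
  is_primary_function f A B -> is_primary_function f A B' -> B = B'.
Proof.
move=> [p [fp Bp]] [q [fq Bq]]; apply: (@map_mx_inj _ _ (@base_emb R k)).
rewrite -/(to_complex B) -/(to_complex B') Bp Bq.
apply/eqP; rewrite -subr_eq0 -rmorphB -dvd_mxminpoly.
set P := mxminpoly _; have [s Ps] := closed_field_poly_normal P.
have monP : P \is monic by exact: mxminpoly_monic.
rewrite (monicP monP) scale1r in Ps; rewrite Ps; apply: dvdp_mup => z.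
apply: dvdp_derivn => j jz; rewrite derivnB hornerD hornerN fp ?fq ?subrr//.
all: by rewrite -/P Ps mu_prod_XsubC.
Qed.

Lemma principal_sqrt_unique (k : ground) n (A Y Z : 'M[base R k]_n) :
  is_principal_sqrt A Y -> is_principal_sqrt A Z -> Y = Z.
Proof.
case: n A Y Z => [|n] A Y Z; first by rewrite [Y]flatmx0 [Z]flatmx0.
move=> [Ypos YA] [Zpos ZA]; apply: (@map_mx_inj _ _ (@base_emb R k)).
rewrite -/(to_complex Y) -/(to_complex Z).
move: Ypos Zpos; rewrite /r_positive_definite.
have : to_complex Y *m to_complex Y = to_complex Z *m to_complex Z.
  by rewrite -!map_mxM YA ZA.
move: (to_complex Y) (to_complex Z) => {A YA ZA}{}Y {}Z YZ Ypos Zpos.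
have [D DE] : exists D : 'M_n.+1, D = Y - Z by exists (Y - Z).
have YD : Y * D = D * - Z.
  rewrite DE mulrBr mulrN mulrBl opprB; congr (_ - _); exact: YZ.
have pD p : horner_mx Y p * D = D * horner_mx (- Z) p.
  elim/poly_ind: p => [|p c IHp]; first by rewrite !rmorph0 mul0r mulr0.
  rewrite !rmorphD !rmorphM /= !horner_mx_X !horner_mx_C mulrDl mulrDr.
  rewrite -mulrA YD mulrA IHp mulrA; congr (_ + _).
  by rewrite -[LHS]/(c%:M *m D) -scalar_mxC.
have [s Ps] := closed_field_poly_normal (char_poly (- Z)).
rewrite (monicP (char_poly_monic _)) scale1r in Ps.
have qU : horner_mx Y (char_poly (- Z)) \is a GRing.unit.
  have rootsP z : z \in s -> complex.Re z < 0.
    move=> zs; have : eigenvalue (- Z) z.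
      by rewrite eigenvalue_root_char Ps root_prod_XsubC.
    move=> /eigenvalueP[v vZ v0]; have : eigenvalue Z (- z).
      by apply/eigenvalueP; exists v; rewrite // scaleNr -vZ mulmxN opprK.
    by move=> /Zpos; rewrite raddfN /= oppr_gt0.
  rewrite Ps rmorph_prod /= big_seq; apply: (big_ind (fun M => M \is a GRing.unit)).
  - exact: unitr1.
  - by move=> M N MU NU; rewrite unitrMl.
  - move=> z zs; rewrite rmorphB /= horner_mx_X horner_mx_C.
    case: (boolP (Y - z%:M \in unitmx)) => // nU; have /Ypos : eigenvalue Y z.
      by rewrite /eigenvalue /eigenspace kermx_eq0 row_free_unit.
    by rewrite ltNge ltW// rootsP.
apply/eqP; rewrite -subr_eq0 -DE; apply/eqP.
apply: (mulrI qU); rewrite mulr0 pD.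
by rewrite Cayley_Hamilton mulr0.
Qed.

End WellDefined.

(* Main.v *)
(* Write A = F^[H] F and W = F S^-1.  Sigma is a polynomial in A and S is the unique
   r-positive-definite root of Sigma A, so that S is H-selfadjoint and commutes with
   Sigma, and S' = F S F^-1.  Therefore F = W S = S' W with W^dagger H W = H Sigma,
   and H and H Sigma have the same inertia.  As Sigma is H-selfadjoint and
   involutory, H and Sigma are diagonal with entries 1 and -1 in a common basis, and
   on the (-1)-eigenspace of Sigma the form H has as many positive as negative
   squares.  Exchanging these in pairs gives an involution X with
   X^dagger H X = H Sigma, and L = W X is H-unitary.  The factors in the other order
   are L X L^-1 and L. *)

Require Import Defs.
From mathcomp Require Import all_boot all_order all_algebra.
From mathcomp Require Import boolp classical_sets reals complex.
From mathcomp Require Import ring.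

Set Implicit Arguments.
Unset Strict Implicit.
Unset Printing Implicit Defensive.

Import Order.TTheory GRing.Theory Num.Theory.
Local Open Scope ring_scope.

(** * Conjugation, positivity and the conjugate transpose, uniformly in the two ground fields *)

Section BaseField.
Variables (R : realType) (k : ground).
Local Notation K := (base R k).
Local Notation emb := (@base_emb R k).
Local Notation conj := (@base_conj R k).

Lemma base_conjK : involutive conj.
Proof. by case: k => //; exact: conjcK. Qed.

Lemma base_emb_conj (x : K) : emb (conj x) = conjc (emb x).
Proof. by case: k x => //= x; rewrite oppr0. Qed.

Lemma base_emb_real (x : K) : conj x = x -> emb x \is Num.real.
Proof.
case: k x => /= x; first by move=> _; apply/complex_realP; exists x.
case: x => a b [] /eqP; rewrite eq_sym -addr_eq0 -mulr2n mulrn_eq0 /= => /eqP->.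
by rewrite complex_real.
Qed.

(** Negative real numbers lie in both ground fields, so the negative eigenvalues of a real matrix
    can be split off by polynomials over [K]. *)
Lemma base_emb_neg (z : R[i]) : z < 0 -> exists a : K, emb a = z.
Proof.
case: k => /= z0; last by exists z.
have /ltr0_real/complex_realP[a ->] := z0; by exists a.
Qed.

Lemma base_norm_ge0 (x : K) : 0 <= emb (conj x * x).
Proof. by rewrite rmorphM /= base_emb_conj mulrC mulcJ_ge0. Qed.

Lemma base_norm_eq0 (x : K) : (conj x * x == 0) = (x == 0).
Proof. by rewrite mulf_eq0 fmorph_eq0 orbb. Qed.

Lemma base_sqrt (x : K) : 0 < emb x -> exists2 c : K, c != 0 & conj c * c = x.
Proof.
case: k x => /= x x0.
  have {}x0 : 0 < x by move: x0; rewrite ltcE /= eqxx.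
  exists (Num.sqrt x); first by rewrite gt_eqF// sqrtr_gt0.
  by rewrite -expr2 sqr_sqrtr// ltW.
exists (sqrtc x); first by rewrite sqrtc_eq0 gt_eqF.
(* The root of a positive number is real, hence equal to its conjugate. *)
have /ger0_Im s0 : 0 <= sqrtc x by rewrite sqrtc_ge0 ltW.
rewrite -[RHS]sqr_sqrtc expr2; congr (_ * _).
by case: (sqrtc x) s0 => a b /= ->; rewrite oppr0.
Qed.

Lemma daggerM m n p (A : 'M[K]_(m, n)) (B : 'M[K]_(n, p)) :
  dagger (A *m B) = dagger B *m dagger A.
Proof. by rewrite /dagger trmx_mul map_mxM. Qed.

Lemma daggerK m n (A : 'M[K]_(m, n)) : dagger (dagger A) = A.
Proof. by apply/matrixP => i j; rewrite !mxE base_conjK. Qed.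

Lemma daggerD m n (A B : 'M[K]_(m, n)) : dagger (A + B) = dagger A + dagger B.
Proof. by rewrite /dagger raddfD map_mxD. Qed.

Lemma daggerN m n (A : 'M[K]_(m, n)) : dagger (- A) = - dagger A.
Proof. by rewrite /dagger raddfN map_mxN. Qed.

Lemma dagger1 n : dagger 1%:M = 1%:M :> 'M[K]_n.
Proof. by rewrite /dagger trmx1 map_mx1. Qed.

Lemma dagger0 m n : dagger 0 = 0 :> 'M[K]_(m, n).
Proof. by rewrite /dagger trmx0 map_mx0. Qed.

Lemma daggerZ m n (a : K) (A : 'M[K]_(m, n)) :
  dagger (a *: A) = conj a *: dagger A.
Proof. by rewrite /dagger linearZ map_mxZ. Qed.

Lemma dagger_invmx n (A : 'M[K]_n) : dagger (invmx A) = invmx (dagger A).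
Proof. by rewrite /dagger trmx_inv map_invmx. Qed.

Lemma dagger_unit n (A : 'M[K]_n) : (dagger A \in unitmx) = (A \in unitmx).
Proof. by rewrite /dagger map_unitmx unitmx_tr. Qed.

End BaseField.

(** * Similarity, transposition and polynomials in a matrix *)

Section Similarity.
Variables (F : fieldType) (n : nat).
Implicit Types P A : 'M[F]_n.+1.

Lemma char_poly_conj P A :
  P \in unitmx -> char_poly (P *m A *m invmx P) = char_poly A.
Proof.
move=> PU; pose Q : 'M_n.+1 -> 'M_n.+1 := map_mx (@polyC F).
have QP : Q P *m Q (invmx P) = 1%:M by rewrite -map_mxM mulmxV// map_mx1.
rewrite /char_poly /char_poly_mx.
have -> : 'X%:M - Q (P *m A *m invmx P) = Q P *m ('X%:M - Q A) *m Q (invmx P).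
  rewrite mulmxBr mulmxBl -!map_mxM; congr (_ - _).
  by rewrite scalar_mxC -mulmxA QP mulmx1.
by rewrite !det_mulmx mulrAC -det_mulmx QP det1 mul1r.
Qed.

Lemma char_poly_tr A : char_poly A^T = char_poly A.
Proof.
rewrite /char_poly -det_tr; congr (\det _).
by apply/matrixP => i j; rewrite !mxE eq_sym.
Qed.

Lemma horner_mx_tr A p : horner_mx A^T p = (horner_mx A p)^T.
Proof.
elim/poly_ind: p => [|p c IHp]; first by rewrite !rmorph0 trmx0.
rewrite !rmorphD !rmorphM /= !horner_mx_X !horner_mx_C.
rewrite linearD /= tr_scalar_mx IHp -[_ * A^T]trmx_mul; congr (_^T + _).
by apply: esym; apply: comm_horner_mx; exact: comm_mx_refl.
Qed.

Lemma horner_mx_dvdp A p : char_poly A %| p -> horner_mx A p = 0.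
Proof. by move=> /dvdpP[q ->]; rewrite rmorphM /= Cayley_Hamilton mulr0. Qed.

Lemma horner_mx_unit A p : coprimep p (char_poly A) -> horner_mx A p \in unitmx.
Proof.
move=> /Bezout_eq1_coprimepP[[u v] /= /(congr1 (horner_mx A))].
rewrite rmorphD !rmorphM /= Cayley_Hamilton mulr0 addr0 rmorph1 => uA.
by have /mulmx1_unit[] := uA.
Qed.

End Similarity.

(** Spectral mapping. If [p - z] were coprime to the characteristic polynomial, [p(A) - z] would be
    invertible; over a closed field the two therefore share a root. *)
Lemma eigenvalue_horner_mx (F : closedFieldType) n (A : 'M[F]_n.+1) p z :
  eigenvalue (horner_mx A p) z -> exists2 a, eigenvalue A a & z = p.[a].
Proof.
move=> Az; have [co|nco] := boolP (coprimep (p - z%:P) (char_poly A)).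
  have := horner_mx_unit co; rewrite rmorphB /= horner_mx_C -row_free_unit.
  by rewrite -kermx_eq0; move: Az; rewrite /eigenvalue /eigenspace => /negPf->.
have [a pa ra] : exists2 a, root (p - z%:P) a & root (char_poly A) a.
  apply: contrapT => H; move/negP: nco; apply.
  apply/Pdiv.ClosedField.coprimepP => a pa; apply/negP => ra; apply: H.
  by exists a.
exists a; first by rewrite eigenvalue_root_char.
by move: pa; rewrite rootE !hornerE subr_eq0 => /eqP->.
Qed.

(** * The [H]-adjoint and its effect on polynomials and spectra *)

Section Adjoint.
Variables (R : realType) (k : ground) (n : nat).
Local Notation K := (base R k).
Local Notation emb := (@base_emb R k).
Local Notation conj := (@base_conj R k).
Variable H : 'M[K]_n.+1.
Hypotheses (HU : H \in unitmx) (Hsa : selfadjoint H).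
Implicit Types A B Y : 'M[K]_n.+1.

Lemma adjM A B : adj H (A *m B) = adj H B *m adj H A.
Proof. by rewrite /adj daggerM !mulmxA mulmxK. Qed.

Lemma adjK A : adj H (adj H A) = A.
Proof.
rewrite /adj !daggerM daggerK dagger_invmx Hsa !mulmxA mulVmx// mul1mx.
by rewrite mulmxKV.
Qed.

Lemma adj1 : adj H 1%:M = 1%:M.
Proof. by rewrite /adj dagger1 mulmx1 mulVmx. Qed.

Lemma adj_unit A : A \in unitmx -> adj H A \in unitmx.
Proof. by move=> AU; rewrite !unitmx_mul unitmx_inv HU dagger_unit AU. Qed.

Lemma adjV A : A \in unitmx -> adj H (invmx A) = invmx (adj H A).
Proof.
move=> AU; apply: (can_inj (mulmxK (adj_unit AU))).
by rewrite mulVmx ?adj_unit// -adjM mulmxV// adj1.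
Qed.

(** [adj H A] is similar to the conjugate transpose of [A], and transposition commutes with taking
    polynomials, so only the coefficients get conjugated. *)
Lemma adj_horner_mx A p :
  adj H (horner_mx A p) = horner_mx (adj H A) (map_poly conj p).
Proof.
rewrite /adj /dagger -horner_mx_tr map_horner_mx.
have := @horner_mx_uconj _ _ (map_poly conj p) (invmx H) (map_mx conj A^T).
by rewrite invmxK => -> //; rewrite -[_ \is a _]/(invmx H \in unitmx) unitmx_inv.
Qed.

Lemma char_poly_adj A : char_poly (adj H A) = map_poly conj (char_poly A).
Proof.
rewrite /adj /dagger -{2}[H]invmxK char_poly_conj ?unitmx_inv//.
by rewrite -map_char_poly char_poly_tr.
Qed.

Lemma eigenvalue_to_complex_adj A z :
  eigenvalue (to_complex (adj H A)) z -> eigenvalue (to_complex A) (conjc z).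
Proof.
rewrite !eigenvalue_root_char -!map_char_poly char_poly_adj -map_poly_comp.
rewrite (eq_map_poly (g := @conjc R \o emb));
    last exact: base_emb_conj.
by rewrite map_poly_comp -{1}[z]conjcK /root horner_map fmorph_eq0.
Qed.

Lemma r_positive_definite_adj Y : r_positive_definite Y -> r_positive_definite (adj H Y).
Proof. by move=> Yp z /eigenvalue_to_complex_adj/Yp; case: z. Qed.

End Adjoint.

(** * Principal square roots under similarity and adjunction *)

Section PrincipalSqrt.
Variables (R : realType) (k : ground) (n : nat).
Local Notation K := (base R k).
Implicit Types A B Y P : 'M[K]_n.+1.

Lemma principal_sqrtP A Y : is_principal_sqrt A Y -> principal_sqrt A = Y.
Proof.
move=> YA; apply: xget_unique => // Z ZA; exact: principal_sqrt_unique ZA YA.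
Qed.

Lemma r_positive_definite_conj P Y : P \in unitmx ->
  r_positive_definite Y -> r_positive_definite (P *m Y *m invmx P).
Proof.
move=> PU Yp z zPY; apply: Yp; move: zPY.
by rewrite !eigenvalue_root_char -!map_char_poly char_poly_conj.
Qed.

(** Together with uniqueness this yields both that [S] commutes with [Sigma] (conjugate by [Sigma])
    and that [S' = F S F^-1] (conjugate by [F]). *)
Lemma conj_principal_sqrt P A Y : P \in unitmx ->
  is_principal_sqrt A Y ->
  is_principal_sqrt (P *m A *m invmx P) (P *m Y *m invmx P).
Proof.
move=> PU [Yp <-]; split; first exact: r_positive_definite_conj.
by rewrite !mulmxA mulmxKV.
Qed.

(** With uniqueness, a principal root of an [H]-selfadjoint matrix is [H]-selfadjoint. *)
Lemma adj_principal_sqrt H A Y : H \in unitmx ->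
  is_principal_sqrt A Y -> is_principal_sqrt (adj H A) (adj H Y).
Proof. by move=> HU [Yp <-]; split; [exact: r_positive_definite_adj|rewrite adjM]. Qed.

End PrincipalSqrt.

(** * Existence of the principal square root *)

Section SqrtExistence.
Variable R : realType.
Local Notation C := R[i].

Lemma csqrt_Re_gt0 (z : C) :
  ~~ (z <= 0) -> exists2 y : C, y ^+ 2 = z & 0 < complex.Re y.
Proof.
move=> z0; pose y := sqrtc z; have yz : y ^+ 2 = z by exact: sqr_sqrtc.
have [y0|y0|y0] := ltgtP (complex.Re y) 0.
- by exists (- y); rewrite ?sqrrN// raddfN oppr_gt0.
- by exists y.
(* A purely imaginary [y] would make [z] the negative of a real square. *)
case: y yz y0 => a b /= yz a0; case/negP: z0; rewrite -yz a0 expr2.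
by rewrite lecE /= !mul0r mulr0 addr0 eqxx sub0r oppr_le0 -expr2 sqr_ge0.
Qed.

(* One Newton step per root: [q + c * m] still squares to ['X] modulo [m], and
   [c] is chosen so that it does so modulo [('X - z) * m]. *)
Lemma poly_sqrt_mod (s : seq C) : all (fun z => ~~ (z <= 0)) s ->
  exists2 q : {poly C}, \prod_(z <- s) ('X - z%:P) %| q ^+ 2 - 'X &
    {in s, forall z, 0 < complex.Re q.[z]}.
Proof.
elim: s => [|z s IHs] /=; first by exists 0; rewrite ?big_nil ?dvd1p.
move=> /andP[z0 /IHs[q /dvdpP[r qr] qpos]].
rewrite big_cons; set m := \prod_(j <- s) _ in qr *.
have mroot w : root m w = (w \in s) by rewrite root_prod_XsubC.
have step c : (q + c%:P * m) ^+ 2 - 'X =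
    (r + (c *+ 2)%:P * q + (c ^+ 2)%:P * m) * m.
  rewrite rmorphMn rmorphXn /=.
  have -> : (q + c%:P * m) ^+ 2 - 'X =
      q ^+ 2 - 'X + (c%:P *+ 2 * q + c%:P ^+ 2 * m) * m by ring.
  by rewrite qr; ring.
have qs c w : w \in s -> (q + c%:P * m).[w] = q.[w].
  by rewrite -mroot => /rootP mw; rewrite !hornerE mw mulr0 addr0.
suff [c rc qc] : exists2 c, root (r + (c *+ 2)%:P * q + (c ^+ 2)%:P * m) z &
    0 < complex.Re (q + c%:P * m).[z].
  exists (q + c%:P * m); first by rewrite step dvdp_mul// -root_factor_theorem.
  move=> w; rewrite inE => /predU1P[->//|ws]; rewrite qs//; exact: qpos.
(* Repeated root: [m] vanishes at [z], so the condition on [c] is linear, with coefficient [2 q(z)];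
   this is nonzero because [q(z)] has positive real part. *)
have [zs|zs] := boolP (z \in s).
  exists (- r.[z] / (q.[z] *+ 2)); last by rewrite qs// qpos.
  have q0 : q.[z] != 0.
    by apply: contraTneq (qpos z zs) => ->; rewrite /= ltxx.
  move: (zs); rewrite -mroot => /rootP mz.
  apply/rootP; rewrite !hornerE mz mulr0 addr0 -mulrnAl mulrAC.
  by rewrite mulrnAl -mulrnAr -mulrA divff ?mulrn_eq0// mulr1 addrN.
(* New root: [c] makes the new polynomial take at [z] the value [y], the root of [z] in the right
   half-plane. Since [m] does not vanish at [z], the cofactor in [step] must. *)
have [y yz ypos] := csqrt_Re_gt0 z0.
have mz : m.[z] != 0 by move: zs; rewrite -mroot.
pose c := (y - q.[z]) / m.[z].
have qz : (q + c%:P * m).[z] = y by rewrite !hornerE divfK// addrC subrK.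
exists c; last by rewrite qz.
have /(congr1 (horner^~ z)) := step c; rewrite hornerD horner_exp qz yz.
rewrite hornerN hornerX subrr hornerM => /esym/eqP.
by rewrite mulf_eq0 (negPf mz) orbF.
Qed.

Lemma complex_principal_sqrt n (A : 'M[base R ComplexGround]_n.+1) :
  (forall z, eigenvalue (to_complex A) z -> ~~ (z <= 0)) ->
  exists Y, is_principal_sqrt A Y.
Proof.
move=> Apos.
have tcE (B : 'M[base R ComplexGround]_n.+1) : to_complex B = B :> 'M[C]_n.+1.
  by apply/matrixP => i j; rewrite mxE.
rewrite tcE in Apos.
have [s Es] := closed_field_poly_normal (char_poly (A : 'M[C]_n.+1)).
rewrite (monicP (char_poly_monic _)) scale1r in Es.
have eigs z : eigenvalue (A : 'M[C]_n.+1) z = (z \in s).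
  by rewrite eigenvalue_root_char Es root_prod_XsubC.
have /poly_sqrt_mod[q qX qpos] : all (fun z => ~~ (z <= 0)) s.
  by apply/allP => z; rewrite -eigs; exact: Apos.
exists (horner_mx (A : 'M[C]_n.+1) q); split.
  move=> z; rewrite tcE => /eigenvalue_horner_mx[a]; rewrite eigs => /qpos + ->.
  by [].
rewrite -Es in qX; have /eqP := horner_mx_dvdp qX.
by rewrite rmorphB /= horner_mx_X subr_eq0 rmorphXn /= expr2 => /eqP.
Qed.

(** For a real matrix, the entrywise conjugate of the complex principal root is again a principal
    root; by uniqueness the root is real. *)
Lemma exists_principal_sqrt (k : ground) n (A : 'M[base R k]_n.+1) :
  (forall z, eigenvalue (to_complex A) z -> ~~ (z <= 0)) ->
  exists Y, is_principal_sqrt A Y.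
Proof.
case: k A => A Apos; last exact: complex_principal_sqrt.
pose A' : 'M[base R ComplexGround]_n.+1 := to_complex A.
have idE m (B : 'M[base R ComplexGround]_m) : to_complex B = B :> 'M[C]_m.
  by apply/matrixP => i j; rewrite mxE.
have [Y YA] : exists Y, is_principal_sqrt A' Y.
  by apply: complex_principal_sqrt => z; rewrite idE; exact: Apos.
pose cY : 'M[base R ComplexGround]_n.+1 := map_mx (@conjc R) Y.
have cYA : is_principal_sqrt A' cY.
  case: YA => Yp YYA; split.
    move=> z; rewrite idE eigenvalue_root_char -map_char_poly.
    rewrite -[z]conjcK /root horner_map fmorph_eq0 => Yz.
    by have := Yp (conjc z); rewrite idE eigenvalue_root_char => /(_ Yz); case: (z).
  rewrite /cY -map_mxM YYA; apply/matrixP => i j; rewrite !mxE.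
  exact: conjc_real.
have YcY := principal_sqrt_unique YA cYA.
pose Z : 'M[base R RealGround]_n.+1 := map_mx (@complex.Re R) Y.
have ZY : to_complex Z = Y.
  apply/matrixP => i j; rewrite !mxE; apply: RRe_real.
  apply: (@base_emb_real R ComplexGround); have /matrixP/(_ i j) := YcY.
  by rewrite mxE.
case: YA => Yp YYA; exists Z; split; first by rewrite /r_positive_definite ZY -[Y]idE.
apply: (@map_mx_inj _ _ (@base_emb R RealGround)); rewrite map_mxM.
by rewrite -/(to_complex Z) ZY YYA.
Qed.

End SqrtExistence.

(** Each derivation lowers the order of vanishing by at most one. This turns divisibility into the
    Hermite conditions that define a primary function. *)
Lemma horner_derivn_eq0 (F : fieldType) (d : {poly F}) z m j :
  ('X - z%:P) ^+ m %| d -> (j < m)%N -> d^`(j).[z] = 0.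
Proof.
elim: j m d => [|j IHj] [|m]// d /dvdpP[e ->] jm.
  by rewrite derivn0 exprS !hornerM hornerXsubC subrr mul0r mulr0.
rewrite derivSn; apply: (IHj m) => //.
rewrite derivM deriv_exp derivXsubC mul1r /= mulrnAr -mulr_natl.
by apply: dvdp_add; rewrite !dvdp_mull// exprSr dvdp_mulr.
Qed.

(** * The sign of a matrix as a polynomial in it *)

Section SignPolynomial.
Variables (R : realType) (k : ground).
Local Notation K := (base R k).
Local Notation emb := (@base_emb R k).
Local Notation conj := (@base_conj R k).
Implicit Types a b c p : {poly K}.

(* Interpolates [Sign] at the roots of [c]: [a] gathers the roots of [c] that are
   negative real numbers, and [b] the other ones. *)
Definition sign_poly c p := exists a b,
  [/\ c = a * b, forall z, root (map_poly emb a) z -> z < 0,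
      forall z, z < 0 -> ~~ root (map_poly emb b) z, a %| p + 1 & b %| p - 1].

(** Induction on the size: a negative real root comes from [K], so its linear factor can be divided
    out over [K]. *)
Lemma split_negative_roots c : c != 0 -> exists a b,
  [/\ c = a * b, forall z, root (map_poly emb a) z -> z < 0 &
      forall z, z < 0 -> ~~ root (map_poly emb b) z].
Proof.
have [m] := ubnP (size c); elim: m c => // m IHm c cm c0.
have [[z [z0 cz]]|nroot] := pselect (exists z, z < 0 /\ root (map_poly emb c) z);
  last first.
  exists 1, c; split; rewrite ?mul1r// => z; last first.
    by move=> z0; apply/negP => cz; apply: nroot; exists z.
  by rewrite rmorph1 (negPf (root1 _)).
have [x xz] := base_emb_neg k z0.
move: cz; rewrite -xz rootE horner_map fmorph_eq0 => /factor_theorem[q cq].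
have q0 : q != 0 by apply: contraNneq c0 => q0; rewrite cq q0 mul0r.
have [] := IHm q; rewrite ?q0//.
  by move: cm; rewrite cq size_Mmonic ?monicXsubC// size_XsubC addn2.
move=> a [b [qab aneg bneg]]; exists (('X - x%:P) * a), b; split=> //.
  by rewrite cq qab mulrC mulrA.
move=> w; rewrite rmorphM /= rootM => /orP[|/aneg//].
by rewrite map_polyXsubC /= root_XsubC => /eqP->; rewrite xz.
Qed.

Lemma sign_poly_exists c : c != 0 -> exists p, sign_poly c p.
Proof.
move=> /split_negative_roots[a [b [cab aneg bneg]]].
have : coprimep a b.
  rewrite -(coprimep_map emb); apply/Pdiv.ClosedField.coprimepP => z /aneg.
  exact: bneg.
move=> /Bezout_eq1_coprimepP[[u v] /= uv].
(* Since [u a + v b = 1], adding or subtracting 1 leaves [2 u a] or [-2 v b]. *)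
exists (u * a - v * b), a, b; split=> //; rewrite -uv.
  have -> : u * a - v * b + (u * a + v * b) = (u *+ 2) * a by ring.
  exact: dvdp_mull.
have -> : u * a - v * b - (u * a + v * b) = (- v *+ 2) * b by ring.
exact: dvdp_mull.
Qed.

(** Conjugation preserves the set of negative real numbers, so it sorts the roots in the same way.
    This is what makes [Sigma] [H]-selfadjoint. *)
Lemma sign_poly_conj c p :
  sign_poly c p -> sign_poly (map_poly conj c) (map_poly conj p).
Proof.
move=> [a [b [cab aneg bneg ap bp]]].
have rootJ q z : root (map_poly emb (map_poly conj q)) z =
                 root (map_poly emb q) (conjc z).
  rewrite -map_poly_comp (eq_map_poly (g := @conjc R \o emb));
    last exact: base_emb_conj.
  by rewrite map_poly_comp -{1}[z]conjcK /root horner_map fmorph_eq0.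
have negJ (z : R[i]) : (conjc z < 0) = (z < 0).
  by case: z => x y; rewrite !ltcE /= eq_sym oppr_eq0 eq_sym.
exists (map_poly conj a), (map_poly conj b); split.
- by rewrite cab rmorphM.
- by move=> z; rewrite rootJ => /aneg; rewrite negJ.
- by move=> z; rewrite -negJ rootJ; exact: bneg.
- by rewrite -(rmorph1 (map_poly conj)) -rmorphD dvdp_map.
- by rewrite -(rmorph1 (map_poly conj)) -rmorphB dvdp_map.
Qed.

Section Matrix.
Variable n : nat.
Implicit Type A : 'M[K]_n.+1.

(** At each [z] only one of [a], [b] can vanish, so the whole power of [X - z] in the minimal
    polynomial divides [p + 1] or [p - 1]. Hence [p] has there the derivatives of a constant. *)
Lemma SignE A p : sign_poly (char_poly A) p -> Sign A = horner_mx A p.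
Proof.
move=> [a [b [cab aneg bneg ap bp]]].
suff pA : is_primary_function (@sign_fun R) A (horner_mx A p).
  apply: xget_unique => // B AB; exact: primary_function_unique AB pA.
exists (map_poly emb p); split; last exact: map_horner_mx.
move=> z j; set m := mup _ _ => jm.
have mc : ('X - z%:P) ^+ m %| map_poly emb a * map_poly emb b.
  rewrite -rmorphM -cab /= map_char_poly.
  apply: dvdp_trans (mxminpoly_dvd_char _); rewrite -mup_geq//.
  exact/monic_neq0/mxminpoly_monic.
have coXz q : ~~ root q z -> coprimep (('X - z%:P) ^+ m) q.
  by move=> qz; rewrite coprimep_expl// coprimep_sym coprimep_XsubC.
have : ('X - z%:P) ^+ m %| map_poly emb p - (sign_fun 0 z)%:P.
  rewrite /=; case: ifP => z0; last first.
    rewrite rmorph1 -(rmorph1 (map_poly emb)) -rmorphB.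
    move: mc; rewrite Gauss_dvdpr ?coXz//; last first.
      by apply/negP => /aneg; rewrite z0.
    by move=> /dvdp_trans; apply; rewrite dvdp_map.
  rewrite rmorphN opprK rmorph1 -(rmorph1 (map_poly emb)) -rmorphD.
  move: mc; rewrite Gauss_dvdpl ?coXz ?bneg//.
  by move=> /dvdp_trans; apply; rewrite dvdp_map.
move=> /horner_derivn_eq0/(_ jm); rewrite derivnB hornerD hornerN => /eqP.
by rewrite subr_eq0 => /eqP ->; rewrite derivnC; case: (j) => [|i]; rewrite !hornerE.
Qed.

(** The characteristic polynomial [a b] divides [(p + 1)(p - 1)]; Cayley-Hamilton concludes. *)
Lemma sign_poly_involutory A p :
  sign_poly (char_poly A) p -> horner_mx A p *m horner_mx A p = 1%:M.
Proof.
move=> [a [b [cab _ _ ap bp]]].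
have : char_poly A %| p ^+ 2 - 1 ^+ 2 by rewrite subr_sqr mulrC cab dvdp_mul.
move=> /horner_mx_dvdp/eqP; rewrite rmorphB !rmorphXn /= rmorph1 subr_eq0.
by rewrite expr1n expr2 => /eqP.
Qed.

(** By spectral mapping the eigenvalues are [p(w) w] with [w] an eigenvalue of [A], that is [-w] for
    negative [w] and [w] otherwise; [w] is nonzero because [A] is invertible. *)
Lemma sign_mul_eigenvalue A p z : A \in unitmx -> sign_poly (char_poly A) p ->
  eigenvalue (to_complex (horner_mx A p *m A)) z -> ~~ (z <= 0).
Proof.
move=> AU [a [b [cab aneg bneg ap bp]]].
have -> : to_complex (horner_mx A p *m A) =
    horner_mx (to_complex A) (map_poly emb p * 'X).
  by rewrite /to_complex map_mxM rmorphM /= horner_mx_X map_horner_mx.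
move=> /eigenvalue_horner_mx[w Aw ->]; rewrite hornerM hornerX.
move: (Aw); rewrite eigenvalue_root_char -map_char_poly cab rmorphM /= rootM.
have dvdw q r : q %| r -> root (map_poly emb q) w -> (map_poly emb r).[w] = 0.
  rewrite -(dvdp_map emb) => qr; rewrite -!dvdp_XsubCl => /dvdp_trans/(_ qr).
  by rewrite dvdp_XsubCl => /rootP.
move=> /orP[aw|bw].
  have := dvdw _ _ ap aw; rewrite rmorphD rmorph1 !hornerE => /eqP.
  by rewrite addr_eq0 => /eqP->; rewrite mulN1r oppr_le0 lt_geF// aneg.
have := dvdw _ _ bp bw; rewrite rmorphB rmorph1 !hornerE => /eqP.
rewrite subr_eq0 => /eqP->; rewrite mul1r le_eqVlt negb_or.
rewrite andbC; have [/bneg|_ /=] := boolP (w < 0); first by rewrite bw.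
apply: contraTneq Aw => ->; rewrite /eigenvalue negbK /eigenspace raddf0 subr0.
by rewrite kermx_eq0 row_free_unit map_unitmx.
Qed.

End Matrix.
End SignPolynomial.

Lemma swap_involution (T : finType) (P N : {set T}) :
  #|P| = #|N| -> [disjoint P & N] ->
  exists s : T -> T, [/\ involutive s, {in P, forall i, s i \in N},
    {in N, forall i, s i \in P} & forall i, i \notin P -> i \notin N -> s i = i].
Proof.
move=> PN dPN.
have notN i : i \in P -> i \notin N by move=> iP; rewrite (disjointFr dPN iP).
(* Matches [A] with [B] by position in their enumerations; the default [i] is not reached on [A]
   when the cardinals agree. *)
pose f (A B : {set T}) i := nth i (enum B) (index i (enum A)).
have fP (A B : {set T}) i : #|A| = #|B| -> i \in A -> f A B i \in B.
  move=> AB iA; rewrite -mem_enum mem_nth// -cardE -AB cardE index_mem.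
  by rewrite mem_enum.
have fK (A B : {set T}) i : #|A| = #|B| -> i \in A -> f B A (f A B i) = i.
  move=> AB iA; have iAs : (index i (enum A) < size (enum B))%N.
    by rewrite -cardE -AB cardE index_mem mem_enum.
  rewrite /f index_uniq ?enum_uniq// (set_nth_default i) ?nth_index ?mem_enum//.
  by rewrite -cardE AB cardE.
exists (fun i => if i \in P then f P N i else if i \in N then f N P i else i).
split.
- move=> i; have [iP|iP] := boolP (i \in P).
    have iN := fP _ _ _ PN iP; rewrite iN ifN ?fK//.
    by apply: contraTN iN => /notN.
  have [iN|iN] := boolP (i \in N); last by rewrite (negPf iP) (negPf iN).
  by rewrite fP ?fK.
- by move=> i iP; rewrite iP fP.
- by move=> i iN; rewrite iN ifN ?fP//; apply: contraTN iN => /notN.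
- by move=> i iP iN; rewrite (negPf iP) (negPf iN).
Qed.

(** * Diagonalization of a form together with an involution, and inertia *)

Section Forms.
Variables (R : realType) (k : ground).
Local Notation K := (base R k).
Local Notation emb := (@base_emb R k).
Local Notation conj := (@base_conj R k).

Lemma sqr1_pm (x : K) : x ^+ 2 = 1 -> x = 1 \/ x = -1.
Proof. by move=> /eqP; rewrite sqrf_eq1 => /orP[] /eqP; [left|right]. Qed.

Lemma two_neq0 : 2 != 0 :> K.
Proof. by rewrite -(fmorph_eq0 emb) rmorph_nat pnatr_eq0. Qed.

Lemma conj_sqr1 (x : K) : x ^+ 2 = 1 -> conj x = x.
Proof. by move=> /sqr1_pm[] ->; rewrite ?rmorphN rmorph1. Qed.

Lemma dagger_diag_mx n (d : 'rV[K]_n) :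
  (forall i, d 0 i ^+ 2 = 1) -> dagger (diag_mx d) = diag_mx d.
Proof.
move=> d1; apply/matrixP => i j; rewrite !mxE eq_sym.
by case: eqVneq => [->|_]; rewrite ?rmorph0// !mulr1n conj_sqr1.
Qed.

Lemma diag_mx_sqr1 n (d : 'rV[K]_n) :
  (forall i, d 0 i ^+ 2 = 1) -> diag_mx d *m diag_mx d = 1%:M.
Proof.
move=> d1; apply/matrixP => i j; rewrite mul_diag_mx !mxE.
by case: eqVneq => [->|_]; rewrite ?mulr0// !mulr1n -expr2 d1.
Qed.

(* [e_i + conj (G i j) e_j] is anisotropic if [G i i = G j j = 0 != G i j]. *)
Lemma exists_anisotropic n (G : 'M[K]_n) :
  selfadjoint G -> G != 0 -> exists v, iprod G v v != 0.
Proof.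
move=> Gsa G0; apply: contrapT => iso.
have iso0 v : iprod G v v = 0.
  by apply/eqP/negPn/negP => ?; apply: iso; exists v.
have iprodE (u v : 'cV[K]_n) : iprod G u v = \sum_i \sum_j conj (u i 0) * G i j * v j 0.
  rewrite /iprod -mulmxA mxE; apply: eq_bigr => i _; rewrite !mxE big_distrr /=.
  by apply: eq_bigr => j _; rewrite mulrA.
have entry i j : iprod G (delta_mx i 0) (delta_mx j 0) = G i j.
  rewrite /iprod /dagger trmx_delta map_delta_mx -rowE -colE.
  by rewrite !mxE.
have add a (u v : 'cV[K]_n) : iprod G (u + a *: v) (u + a *: v) =
    iprod G u u + a * iprod G u v + conj a * iprod G v u + conj a * a * iprod G v v.
  rewrite /iprod daggerD daggerZ !mulmxDl !mulmxDr -!scalemxAr -!scalemxAl !mxE.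
  by ring.
case/negP: G0; apply/eqP/matrixP => i j; rewrite mxE.
have := add (conj (G i j)) (delta_mx i 0) (delta_mx j 0).
rewrite !iso0 !entry base_conjK mulr0 addr0 add0r.
have -> : G j i = conj (G i j) by rewrite -{1}Gsa !mxE.
rewrite [G i j * _]mulrC -mulr2n -mulr_natl => /esym/eqP.
by rewrite mulf_eq0 (negPf two_neq0) /= base_norm_eq0 => /eqP.
Qed.

Lemma conj_iprod n (H : 'M[K]_n) v :
  selfadjoint H -> conj (iprod H v v) = iprod H v v.
Proof.
move=> Hsa; have : dagger (dagger v *m H *m v) = dagger v *m H *m v.
  by rewrite !daggerM daggerK Hsa mulmxA.
by move=> /matrixP/(_ 0 0); rewrite 2![in LHS]mxE.
Qed.

(* The [H]-orthogonal projection [P] along the span of [V] commutes with [E], and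
   an eigenvector of [E] anisotropic in its range can be scaled and appended. *)
Lemma simultaneous_diag n (H E : 'M[K]_n) : H \in unitmx -> selfadjoint H ->
    E *m E = 1%:M -> dagger E *m H = H *m E ->
  forall m, (m <= n)%N -> exists (V : 'M[K]_(n, m)) (d e : 'rV[K]_m),
    [/\ forall i, d 0 i ^+ 2 = 1, forall i, e 0 i ^+ 2 = 1,
        dagger V *m H *m V = diag_mx d & E *m V = V *m diag_mx e].
Proof.
move=> HU Hsa EE EH; elim=> [|m IHm] mn.
  exists 0, 0, 0; split=> [[]//|[]//||]; last by rewrite mulmx0 mul0mx.
  by rewrite mulmx0 [RHS]flatmx0.
have [V [d [e [d1 e1 VHV EV]]]] := IHm (ltnW mn).
pose D := diag_mx d; pose P := 1%:M - V *m D *m dagger V *m H.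
have DD : D *m D = 1%:M := diag_mx_sqr1 d1.
have VHP : dagger V *m H *m P = 0.
  by rewrite mulmxBr mulmx1 !mulmxA VHV DD mul1mx subrr.
have PP : P *m P = P.
  by rewrite {1}/P mulmxBl mul1mx -!mulmxA [dagger V *m _]mulmxA VHP !mulmx0 subr0.
have PH : dagger P *m H = H *m P.
  rewrite daggerD daggerN dagger1 mulmxBl mulmxBr mul1mx mulmx1 !daggerM daggerK.
  by rewrite Hsa (dagger_diag_mx d1) !mulmxA.
have PE : E *m P = P *m E.
  rewrite mulmxBl mulmxBr mul1mx mulmx1 !mulmxA EV; congr (_ - _).
  rewrite -[RHS]mulmxA -EH mulmxA -[in RHS](mulmxA _ (dagger V)) -daggerM EV.
  by rewrite daggerM (dagger_diag_mx e1) !mulmxA -[in LHS](mulmxA V) diag_mxC !mulmxA.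
(* Otherwise the identity, of rank [n], would factor through dimension [m < n]. *)
have P0 : P != 0.
  apply: contraTneq mn => /eqP; rewrite subr_eq0 => /eqP P0.
  rewrite -leqNgt -(mxrank1 K n) P0 -!mulmxA.
  exact: mulmx_max_rank.
clearbody P.
(* The image of [T s] consists of vectors [v] in the range of [P] with [E v = s v], and [G s] is the
   form [H] pulled back along [T s]. *)
pose T s := P *m (1%:M + s *: E); pose G s := dagger (T s) *m H *m T s.
have GE s : s ^+ 2 = 1 -> G s = 2 *: (H *m P *m (1%:M + s *: E)).
  move=> s1; have PT : (1%:M + s *: E) *m P = P *m (1%:M + s *: E).
    by rewrite mulmxDl mulmxDr mul1mx mulmx1 -scalemxAl -scalemxAr PE.
  have TH : dagger (T s) *m H = H *m T s.
    rewrite /T daggerM -mulmxA PH mulmxA daggerD dagger1 daggerZ conj_sqr1//.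
    by rewrite -PT mulmxA mulmxDl mulmxDr mul1mx mulmx1 -scalemxAl -scalemxAr EH.
  rewrite /G TH /T -!mulmxA [(_ + _) *m (P *m _)]mulmxA PT -mulmxA.
  rewrite [P *m (P *m _)]mulmxA PP !scalemxAr; congr (_ *m (_ *m _)).
  rewrite mulmxDl mul1mx mulmxDr mulmx1 -scalemxAl -scalemxAr EE scalerA -expr2.
  by rewrite s1 scale1r addrAC addrA scaler_nat mulr2n addrA.
(* Both forms cannot vanish, since [G 1 + G (-1) = 4 H P]. *)
have [s s1 Gs] : exists2 s, s ^+ 2 = 1 & G s != 0.
  have [G1|G1] := eqVneq (G 1) 0; last by exists 1; rewrite ?expr1n.
  exists (-1); rewrite ?sqrrN ?expr1n//; apply: contraNneq P0 => GN.
  have : G 1 + G (-1) = 2 *: (2 *: (H *m P)).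
    rewrite !GE ?sqrrN ?expr1n// -scalerDr -mulmxDr scale1r scaleN1r.
    by rewrite addrACA subrr addr0 -mulr2n -scaler_nat -scalemxAr mulmx1.
  move/eqP; rewrite G1 GN addr0 eq_sym !scaler_eq0 (negPf two_neq0) /= => /eqP HP.
  by rewrite -(mulKmx HU P) HP mulmx0.
have [x xG] : exists v, iprod (G s) v v != 0.
  apply: exists_anisotropic => //.
  rewrite /selfadjoint /G; move: (T s) => U.
  by rewrite !daggerM daggerK Hsa mulmxA.
pose v := T s *m x.
have Ev : E *m v = s *: v.
  rewrite /v /T !mulmxA PE -!mulmxA scalemxAr; congr (_ *m _).
  rewrite mulmxA scalemxAl; congr (_ *m _).
  by rewrite mulmxDr mulmx1 -scalemxAr EE scalerDr scalerA -expr2 s1 scale1r addrC.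
have Vv : dagger V *m H *m v = 0 by rewrite /v /T !mulmxA VHP !mul0mx.
(* [t] is the sign of the real number [h], the form at [v]. Dividing [v] by a [c] with
   [conj c * c = t h] brings the value to [t]. *)
have [c c0 [t t1 ct]] : exists2 c : K, c != 0 & exists2 t : K, t ^+ 2 = 1 &
    (dagger (c *: v) *m H *m (c *: v)) 0 0 = t.
  have vGx : iprod H v v = iprod (G s) x x.
    by rewrite /iprod /v /G daggerM !mulmxA.
  pose h := iprod H v v; have h0 : h != 0 by rewrite /h vGx.
  have hreal : emb h \is Num.real.
    by apply: base_emb_real; exact: conj_iprod.
  have [t t1 th] : exists2 t : K, t ^+ 2 = 1 & 0 < emb (t * h).
    have : emb h != 0 by rewrite fmorph_eq0.
    rewrite real_neqr_lt ?real0// => /orP[hn|hp].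
      by exists (-1); rewrite ?sqrrN ?expr1n// mulN1r rmorphN oppr_gt0.
    by exists 1; rewrite ?expr1n ?mul1r.
  have [c c0 cth] := base_sqrt th.
  exists c^-1; first by rewrite invr_eq0.
  exists t => //; rewrite daggerZ -!scalemxAl -scalemxAr mxE mxE -/(iprod _ _ _).
  rewrite -/h mulrA fmorphV -invfM cth invfM mulfVK//.
  by apply: (mulIf (x := t)); rewrite -?expr2 ?t1 ?mulVf// -sqrf_eq0 t1 oner_eq0.
pose u := c *: v.
have Eu : E *m u = s *: u by rewrite /u -scalemxAr Ev scalerA mulrC -scalerA.
have Vu : dagger V *m H *m u = 0 by rewrite /u -scalemxAr Vv scaler0.
have uV : dagger u *m H *m V = 0.
  by rewrite -[RHS]dagger0 -Vu !daggerM daggerK Hsa mulmxA.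
(* The width is rewritten as [1 + m] to match the type of [row_mx]. *)
suff : exists (V : 'M[K]_(n, 1 + m)) (d e : 'rV[K]_(1 + m)),
  [/\ forall i, d 0 i ^+ 2 = 1, forall i, e 0 i ^+ 2 = 1,
    dagger V *m H *m V = diag_mx d & E *m V = V *m diag_mx e] by [].
rewrite -/u in ct; clearbody u.
exists (row_mx u V), (row_mx t%:M d), (row_mx s%:M e); split.
- by move=> i; rewrite mxE; case: split => j //; rewrite ord1 mxE eqxx.
- by move=> i; rewrite mxE; case: split => j //; rewrite ord1 mxE eqxx.
- rewrite diag_mx_row /dagger tr_row_mx map_col_mx mul_col_mx mul_col_row.
  rewrite -/(dagger u) -/(dagger V) Vu uV VHV; congr block_mx.
  by apply/matrixP => i j; rewrite !ord1 [in RHS]mxE [in RHS]mxE eqxx !mulr1n.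
- rewrite diag_mx_row mul_mx_row mul_row_block !mulmx0 addr0 add0r EV.
  congr row_mx; rewrite Eu; apply/matrixP => i j.
  by rewrite !mxE big_ord1 !ord1 !mxE eqxx !mulr1n mulrC.
Qed.

(** Half of Sylvester's law. If [d'] had more entries 1 than [d], some nonzero [v] supported where
    [d' = 1] would have [Q v] vanishing where [d = 1]; the form would then be both positive and
    nonpositive. *)
Lemma inertia_le n (Q : 'M[K]_n) (d d' : 'rV[K]_n) :
  (forall i, d 0 i ^+ 2 = 1) -> (forall i, d' 0 i ^+ 2 = 1) ->
  dagger Q *m diag_mx d *m Q = diag_mx d' ->
  (#|[set i | d' 0%R i == 1%R]| <= #|[set i | d 0%R i == 1%R]|)%N.
Proof.
move=> d1 d1' QdQ; set B := [set i | _]; set A := [set i | _].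
rewrite leqNgt; apply/negP => AB.
pose rows (S : {set 'I_n}) : 'M[K]_n -> 'M_(#|S|, n) := rowsub enum_val.
(* The kernel of [M] encodes both vanishing conditions; it has [#|A| + n - #|B| < n] rows. *)
pose M := col_mx (rows A Q) (rows (~: B) 1%:M).
have [v v0 Mv] : exists2 v : 'cV[K]_n, v != 0 & M *m v = 0.
  have : kermx M^T != 0.
    rewrite kermx_eq0 /row_free mxrank_tr neq_ltn (leq_ltn_trans (rank_leq_row M))//.
    by rewrite -[X in (_ < X)%N](card_ord n) -(cardsC B) ltn_add2r.
  move=> /rowV0Pn[w /sub_kermxP wM w0]; exists w^T; first by rewrite trmx_eq0.
  by rewrite -[M]trmxK -trmx_mul wM trmx0.
have formE (f : 'rV[K]_n) (u : 'cV[K]_n) :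
    iprod (diag_mx f) u u = \sum_i f 0 i * (conj (u i 0) * u i 0).
  rewrite /iprod -mulmxA mul_diag_mx mxE; apply: eq_bigr => i _.
  by rewrite !mxE mulrCA.
move: Mv; rewrite mul_col_mx -col_mx0 => /eq_col_mx[AQ Bv].
have QA i : d 0 i = 1 -> (Q *m v) i 0 = 0.
  move=> di; have iA : i \in A by rewrite inE di.
  have /matrixP/(_ (enum_rank_in iA i) 0) := AQ.
  by rewrite mul_rowsub_mx !mxE enum_rankK_in.
have vB i : d' 0 i != 1 -> v i 0 = 0.
  move=> di; have iB : i \in ~: B by rewrite !inE.
  have /matrixP/(_ (enum_rank_in iB i) 0) := Bv.
  by rewrite mul_rowsub_mx mul1mx !mxE enum_rankK_in.
have : iprod (diag_mx d') v v = iprod (diag_mx d) (Q *m v) (Q *m v).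
  by rewrite /iprod -QdQ daggerM !mulmxA.
rewrite !formE => /(congr1 emb); rewrite !rmorph_sum => sumE.
have [i vi] : exists i, v i 0 != 0.
  apply: contrapT => allv; case/negP: v0; apply/eqP/matrixP => i j.
  rewrite ord1 mxE; apply/eqP/negPn/negP => vi; apply: allv; by exists i.
have pos j : 0 <= emb (d' 0 j * (conj (v j 0) * v j 0)).
  have [->|/vB->] := eqVneq (d' 0 j) 1; first by rewrite mul1r base_norm_ge0.
  by rewrite !mulr0 rmorph0.
have : 0 < \sum_j emb (d' 0 j * (conj (v j 0) * v j 0)).
  rewrite (bigD1 i)//= ltr_pwDl ?sumr_ge0// lt_def pos andbT fmorph_eq0.
  rewrite mulf_eq0 base_norm_eq0 (negPf vi) orbF.
  by apply: contraNneq vi => di; rewrite vB// di eq_sym oner_eq0.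
rewrite sumE => /lt_geF/negbT/negP[]; rewrite -oppr_ge0 -sumrN sumr_ge0// => j _.
have [/QA->|->] := sqr1_pm (d1 j); first by rewrite !mulr0 rmorph0 oppr0.
by rewrite mulN1r rmorphN opprK base_norm_ge0.
Qed.

End Forms.

(** * The neutral involution carrying [H] to [H Sigma] *)

Section Factorization.
Variables (R : realType) (k : ground).
Local Notation K := (base R k).

(* By inertia, among the basis vectors with [e = -1] as many have [d = 1] as
   [d = -1]; the permutation matrix exchanging them is the neutral involution. *)
Lemma diag_neutral_involution n (Q : 'M[K]_n) (d e : 'rV[K]_n) :
  Q \in unitmx ->
  (forall i, d 0 i ^+ 2 = 1) -> (forall i, e 0 i ^+ 2 = 1) ->
  dagger Q *m diag_mx d *m Q = diag_mx d *m diag_mx e ->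
  exists Y : 'M[K]_n, [/\ Y *m Y = 1%:M,
    dagger Y *m diag_mx d *m Y = diag_mx d *m diag_mx e &
    Y *m (1%:M + diag_mx e) = 1%:M + diag_mx e].
Proof.
move=> QU d1 e1 QdQ; pose f : 'rV[K]_n := \row_i (d 0 i * e 0 i).
have fE : diag_mx d *m diag_mx e = diag_mx f.
  by apply/matrixP => i j; rewrite mul_diag_mx !mxE mulrnAr.
have f1 i : f 0 i ^+ 2 = 1 by rewrite mxE exprMn d1 e1 mulr1.
have one_neqN1 : (1 == -1 :> K) = false.
  by rewrite -addr_eq0 -[1 + 1]/(2%:R) (negPf (two_neq0 _ _)).
pose A := [set i | d 0 i == 1]; pose B := [set i | f 0 i == 1].
pose E := [set i | e 0 i == 1].
(* The two inequalities come from inertia for [Q] and for its inverse. *)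
have AB : #|A| = #|B|.
  apply/eqP; rewrite eqn_leq (inertia_le (Q := Q) d1 f1) ?QdQ// andbT.
  apply: (inertia_le (Q := invmx Q) f1 d1).
  rewrite -fE -QdQ !mulmxA -daggerM mulmxV// dagger1 mul1mx -mulmxA mulmxV//.
  by rewrite mulmx1.
(* Where [e = 1] the entries of [d] and [f] agree, so the excess of [A] and of [B] outside [E] has
   the same size. *)
have ABE : A :&: E = B :&: E.
  apply/setP => i; rewrite !inE mxE andbC [RHS]andbC.
  by case: eqP => //= ->; rewrite mulr1.
have : #|A :\: E| = #|B :\: E|.
  by apply/eqP; rewrite -(eqn_add2l #|A :&: E|) cardsID ABE cardsID AB.
have AE i : i \in A :\: E -> d 0 i = 1 /\ e 0 i = -1.
  rewrite !inE => /andP[+ /eqP->]; split=> //.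
  by move: a => /negPf; case: (sqr1_pm (e1 i)) => -> //; rewrite eqxx.
have BE i : i \in B :\: E -> d 0 i = -1 /\ e 0 i = -1.
  rewrite !inE mxE => /andP[]; have [->|->] := sqr1_pm (e1 i); first by rewrite eqxx.
  by move=> _; rewrite mulrN1 => /eqP <-; rewrite opprK.
move=> /swap_involution[|s [sK sA sB sN]].
  apply/pred0P => i /=; apply/negP => /andP[/AE[di _] /BE[]].
  by rewrite di => /eqP; rewrite one_neqN1.
have sP i : e 0 i = 1 /\ s i = i \/ e 0 i = -1 /\ d 0 (s i) = - d 0 i.
  have [iA|iA] := boolP (i \in A :\: E).
    by right; have [-> ->] := AE _ iA; have [-> _] := BE _ (sA _ iA).
  have [iB|iB] := boolP (i \in B :\: E).
    by right; have [-> ->] := BE _ iB; have [-> _] := AE _ (sB _ iB); rewrite opprK.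
  left; split; last exact: sN.
  move: iA iB; rewrite !inE !negb_and !negbK mxE.
  have [->//|->] := sqr1_pm (e1 i); rewrite eq_sym one_neqN1 /= mulrN1.
  by have [->|->] := sqr1_pm (d1 i); rewrite ?opprK eqxx.
pose Y : 'M[K]_n := rowsub s 1%:M.
have YM m (M : 'M_(n, m)) : Y *m M = rowsub s M by rewrite mul_rowsub_mx mul1mx.
have Ydag : dagger Y = Y.
  apply/matrixP => i j; rewrite !mxE rmorph_nat; congr (_%:R); congr nat_of_bool.
  by apply/eqP/eqP => [<-|<-]; rewrite sK.
exists Y; split.
- by rewrite YM; apply/matrixP => i j; rewrite !mxE sK.
- rewrite Ydag -mulmxA YM fE; apply/matrixP => i j.
  rewrite mxE mul_diag_mx !mxE sK.
  case: eqVneq => _; last by rewrite mulr0.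
  by rewrite mulr1; have [[-> ->]|[-> ->]] := sP i; rewrite ?mulr1 ?mulrN1.
(* The rows of [1 + diag_mx e] that [s] moves are zero. *)
- rewrite YM; apply/matrixP => i j; rewrite !mxE.
  have [[ei ->]|[ei di]] := sP i; first by rewrite ei.
  have si : (s i == i) = false.
    apply/eqP => si; move: di; rewrite si => /eqP; rewrite -addr_eq0 -mulr2n.
    by rewrite -mulr_natl mulf_eq0 (negPf (two_neq0 _ _)) -sqrf_eq0 d1 oner_eq0.
  have esi : e 0 (s i) = -1.
    by have [[_]|[->//]] := sP (s i); rewrite sK => /eqP; rewrite eq_sym si.
  rewrite esi ei; case: (s i == j); case: (i == j);
    by rewrite ?mulr1n ?mulr0n ?addrN ?addr0.
Qed.

(** Passing to a basis [V] that diagonalizes [H] and [E] turns [W] into a congruence between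
    [diag_mx d] and [diag_mx d *m diag_mx e]. The last condition on [X] says that it fixes the
    eigenspace of [E] for 1, which neutrality relies on. *)
Lemma exists_neutral_involution n (H E W : 'M[K]_n) :
  H \in unitmx -> selfadjoint H -> W \in unitmx ->
  E *m E = 1%:M -> dagger E *m H = H *m E -> dagger W *m H *m W = H *m E ->
  exists X : 'M[K]_n, [/\ X *m X = 1%:M, dagger X *m H *m X = H *m E &
    X *m (1%:M + E) = 1%:M + E].
Proof.
move=> HU Hsa WU EE EH WHW.
have [V [d [e [d1 e1 VHV EV]]]] := simultaneous_diag HU Hsa EE EH (leqnn n).
have VU : V \in unitmx.
  have /mulmx1_unit[] : diag_mx d *m dagger V *m H *m V = 1%:M.
    by rewrite -!mulmxA [dagger V *m _]mulmxA VHV diag_mx_sqr1.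
  by [].
have HE : H = dagger (invmx V) *m diag_mx d *m invmx V.
  by rewrite -VHV !mulmxA -daggerM mulmxV// dagger1 mul1mx mulmxK.
have EE' : E = V *m diag_mx e *m invmx V by rewrite -EV mulmxK.
have [] := @diag_neutral_involution n (invmx V *m W *m V) d e.
- by rewrite !unitmx_mul unitmx_inv VU WU.
- by [].
- by [].
- have -> : dagger (invmx V *m W *m V) *m diag_mx d *m (invmx V *m W *m V) =
      dagger V *m (dagger W *m H *m W) *m V.
    by rewrite HE !daggerM !mulmxA.
  by rewrite WHW -VHV -!mulmxA EV.
move=> Y [YY YdY Ye]; exists (V *m Y *m invmx V); split.
- by rewrite !mulmxA mulmxKV// -[V *m Y *m Y]mulmxA YY mulmx1 mulmxV.
- have -> : dagger (V *m Y *m invmx V) *m H *m (V *m Y *m invmx V) =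
      dagger (invmx V) *m (dagger Y *m diag_mx d *m Y) *m invmx V.
    by rewrite !daggerM -VHV !mulmxA.
  by rewrite YdY {1}HE EE' !mulmxA mulmxKV.
- have -> : 1%:M + E = V *m (1%:M + diag_mx e) *m invmx V.
    by rewrite mulmxDr mulmx1 mulmxDl mulmxV// EE'.
  by rewrite !mulmxA mulmxKV// -[V *m Y *m _]mulmxA Ye.
Qed.

End Factorization.

(** * Properties of the polar factors *)

Section Polar.
Variables (R : realType) (k : ground) (n : nat).
Local Notation K := (base R k).
Implicit Types H A P W X S : 'M[K]_n.+1.

(** Similar matrices share their characteristic polynomial, hence a sign polynomial. *)
Lemma Sign_conj P A : P \in unitmx ->
  Sign (P *m A *m invmx P) = P *m Sign A *m invmx P.
Proof.
move=> PU; have [p Ap] := sign_poly_exists (monic_neq0 (char_poly_monic A)).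
by rewrite !(SignE (p := p)) ?char_poly_conj// horner_mx_uconj.
Qed.

(** Serves both [F^[H] F] and [F F^[H]]. The adjoint of [S] and its conjugate by [E] are principal
    roots of the same matrix [E A], so both equal [S]. *)
Lemma polar_sqrt H A : H \in unitmx -> A \in unitmx -> adj H A = A ->
  let E := Sign A in let S := principal_sqrt (E *m A) in
  [/\ E *m E = 1%:M, adj H E = E, is_principal_sqrt (E *m A) S,
      adj H S = S & E *m S = S *m E].
Proof.
move=> HU AU Asa E S.
have [p Ap] := sign_poly_exists (monic_neq0 (char_poly_monic A)).
have Ep : E = horner_mx A p by exact: SignE.
have EE : E *m E = 1%:M by rewrite Ep sign_poly_involutory.
have EU : E \in unitmx by have [] := mulmx1_unit EE.
have Ea : adj H E = E.
  have Ap' : sign_poly (char_poly A) (map_poly (@base_conj R k) p).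
    by have := sign_poly_conj Ap; rewrite -(char_poly_adj HU) Asa.
  by rewrite Ep adj_horner_mx// Asa -(SignE Ap') (SignE Ap).
have EA : E *m A = A *m E by rewrite Ep; exact: comm_horner_mx.
have SA : is_principal_sqrt (E *m A) S.
  have [Y YA] : exists Y, is_principal_sqrt (E *m A) Y.
    by apply: exists_principal_sqrt => z; rewrite Ep; exact: sign_mul_eigenvalue.
  by rewrite /S (principal_sqrtP YA).
split=> //.
  have := adj_principal_sqrt HU SA; rewrite adjM// Asa Ea -EA => SA'.
  exact: principal_sqrt_unique SA' SA.
have EEA : E *m (E *m A) *m invmx E = E *m A by rewrite {1}EA mulmxA mulmxK.
have := conj_principal_sqrt EU SA; rewrite EEA => SA'.
by rewrite -{2}(principal_sqrt_unique SA' SA) mulmxKV.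
Qed.

Lemma adj_eq_mul H A B : H \in unitmx -> adj H A = B <-> dagger A *m H = H *m B.
Proof.
move=> HU; rewrite /adj -mulmxA; split=> [<-|->]; first by rewrite mulKVmx.
by rewrite mulKmx.
Qed.

Lemma adj_M_selfadjoint H E S : H \in unitmx -> E \in unitmx ->
  adj H S = S -> E *m S = S *m E -> M_selfadjoint (H *m E) S.
Proof.
move=> HU EU /(adj_eq_mul _ _ HU) SH ES.
apply/adj_eq_mul; first by rewrite unitmx_mul HU.
by rewrite mulmxA SH -!mulmxA ES.
Qed.

(** [X] commutes with [E] and fixes the image of [1 + E], so [X u = - u] forces [E u = - u]. On such
    vectors [[X u, X v]] equals [[u, v]], and also [- [u, v]] since [X] carries [H] to [H E].
    Normality follows from [X^[H] = E X]. *)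
Lemma neutral_involutionP H E X : H \in unitmx -> selfadjoint H ->
  E *m E = 1%:M -> dagger E *m H = H *m E -> X *m X = 1%:M ->
  dagger X *m H *m X = H *m E -> X *m (1%:M + E) = 1%:M + E ->
  H_normal_neutral_involutory H X.
Proof.
move=> HU Hsa EE EH XX XHX XE.
have XH : dagger X *m H = H *m E *m X by rewrite -XHX -mulmxA XX mulmx1.
have EX : E *m X = X *m E.
  apply: (can_inj (mulKmx HU)); rewrite mulmxA -XH.
  have /(congr1 (@dagger R k _ _)) := XH; rewrite !daggerM daggerK Hsa => HX.
  by rewrite [RHS]mulmxA HX -!mulmxA (mulmxA (dagger E)) EH -mulmxA EE mulmx1.
have neg (u : 'cV_n.+1) : X *m u = - u -> E *m u = - u.
  move=> Xu; have : (1%:M + E) *m u = - ((1%:M + E) *m u).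
    rewrite -{1}XE -mulmxN -Xu mulmxA; congr (_ *m u).
    by rewrite mulmxDr mulmxDl mulmx1 mul1mx EX.
  move/eqP; rewrite -addr_eq0 -mulr2n -scaler_nat scaler_eq0 (negPf (two_neq0 _ _)).
  by rewrite mulmxDl mul1mx addr_eq0 => /eqP {2}->; rewrite opprK.
split; last first.
  rewrite /H_normal; have -> : adj H X = E *m X by apply/adj_eq_mul; rewrite // mulmxA.
  by rewrite mulmxA -EX.
split=> // u v; rewrite /neg_eigenspace /= => Xu Xv.
have uHv : dagger (X *m u) *m H *m (X *m v) = dagger u *m H *m v.
  by rewrite Xu Xv daggerN mulmxN !mulNmx opprK.
have uXHXv : dagger (X *m u) *m H *m (X *m v) = - (dagger u *m H *m v).
  transitivity (dagger u *m (dagger X *m H *m X) *m v).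
    by rewrite daggerM !mulmxA.
  by rewrite XHX -!mulmxA (neg v Xv) !mulmxN.
move/eqP: uHv; rewrite uXHXv eq_sym -addr_eq0 -mulr2n -scaler_nat scaler_eq0.
by rewrite (negPf (two_neq0 _ _)) /iprod => /eqP->; rewrite mxE.
Qed.

Lemma unitary_isometry H L : H \in unitmx -> H_unitary H L ->
  dagger L *m H *m L = H.
Proof.
by move=> HU [LL _]; rewrite ((adj_eq_mul _ _ HU).1 erefl) -mulmxA LL mulmx1.
Qed.

Lemma adj_unitary H L : H \in unitmx -> selfadjoint H ->
  H_unitary H L -> H_unitary H (adj H L).
Proof. by move=> HU Hsa [LL' L'L]; split; rewrite adjK. Qed.

(** [L] preserves the form and its inverse is [adj H L], so conjugation by [L] respects products,
    adjoints and neutral subspaces. *)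
Lemma neutral_involution_conj H L X : H \in unitmx -> selfadjoint H ->
  H_unitary H L -> H_normal_neutral_involutory H X ->
  H_normal_neutral_involutory H (L *m X *m adj H L).
Proof.
move=> HU Hsa LU [[XX Xneu] Xnor]; have [LL' L'L] := LU.
have mulC (M N : 'M_n.+1) :
    L *m M *m adj H L *m (L *m N *m adj H L) = L *m (M *m N) *m adj H L.
  move: (adj H L) LL' => B BL.
  by rewrite !mulmxA -(mulmxA (L *m M) B L) BL mulmx1.
split; first split.
- by rewrite /involutory mulC XX mulmx1.
- move=> u v; rewrite /neg_eigenspace /= => Xu Xv.
  have neg (w : 'cV_n.+1) : L *m X *m adj H L *m w = - w ->
      X *m (adj H L *m w) = - (adj H L *m w).
    move: (adj H L) LL' => B BL Xw.
    by rewrite -mulmxN -Xw !mulmxA BL mul1mx.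
  have := Xneu _ _ (neg u Xu) (neg v Xv).
  have := unitary_isometry HU (adj_unitary HU Hsa LU).
  move: (adj H L) => B BHB; rewrite /iprod daggerM => <-.
  by rewrite -[in LHS]BHB !mulmxA.
- rewrite /H_normal; have -> : adj H (L *m X *m adj H L) = L *m adj H X *m adj H L.
    by rewrite adjM// adjK// adjM// mulmxA.
  by rewrite !mulC Xnor.
Qed.

End Polar.

Theorem theorem6p4 (R : realType) (k : ground) (n : nat)
    (H F : 'M[base R k]_n.+1)
    (H_unit : H \in unitmx) (H_sa : selfadjoint H) (F_unit : F \in unitmx) :
  let Sigma := Sign (adj H F *m F) in
  let Sigma' := Sign (F *m adj H F) in
  let S := principal_sqrt (Sigma *m (adj H F *m F)) in
  let S' := principal_sqrt (Sigma' *m (F *m adj H F)) in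
  [/\ r_positive_definite S, M_selfadjoint H S & M_selfadjoint (H *m Sigma) S] /\
  [/\ r_positive_definite S', M_selfadjoint H S' &
      M_selfadjoint (H *m Sigma') S'] /\
  exists L L1 L' L1' X X1 X' X1' : 'M[base R k]_n.+1,
    [/\ H_unitary H L, H_unitary H L1, H_unitary H L' & H_unitary H L1'] /\
    [/\ H_normal_neutral_involutory H X, H_normal_neutral_involutory H X1,
        H_normal_neutral_involutory H X' & H_normal_neutral_involutory H X1'] /\
    [/\ F = L *m X *m S, F = S' *m L1 *m X1, F = S' *m X' *m L' &
        F = X1' *m L1' *m S] /\
    [/\ L *m X = L1 *m X1, L *m X = X' *m L' & L *m X = X1' *m L1'].
Proof.
move=> E E' S S'; pose A := adj H F *m F; pose A' := F *m adj H F.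
have aFU : adj H F \in unitmx by exact: adj_unit.
have AU : A \in unitmx by rewrite unitmx_mul aFU.
have A'U : A' \in unitmx by rewrite unitmx_mul aFU F_unit.
have Asa : adj H A = A by rewrite adjM// adjK.
have A'sa : adj H A' = A' by rewrite adjM// adjK.
have [EE Ea ES Sa ESC] := polar_sqrt H_unit AU Asa.
have [EE' Ea' ES' Sa' ESC'] := polar_sqrt H_unit A'U A'sa.
rewrite -/E -/S in EE Ea ES Sa ESC; rewrite -/E' -/S' in EE' Ea' ES' Sa' ESC'.
have EU : E \in unitmx by have [] := mulmx1_unit EE.
have EU' : E' \in unitmx by have [] := mulmx1_unit EE'.
have [Sp SS] := ES; have [Sp' _] := ES'.
split; first by split=> //; exact: adj_M_selfadjoint.
split; first by split=> //; exact: adj_M_selfadjoint.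
have SU : S \in unitmx.
  have : S *m S \in unitmx by rewrite SS unitmx_mul EU.
  by rewrite unitmx_mul andbb.
pose W := F *m invmx S.
have WU : W \in unitmx by rewrite unitmx_mul F_unit unitmx_inv.
have FWS : F = W *m S by rewrite /W mulmxKV.
(* [F F^[H]] is the conjugate of [F^[H] F] by [F], hence so are the signs and, by uniqueness, the
   roots. *)
have S'F : S' *m W = F.
  have A'E : A' = F *m A *m invmx F by rewrite /A' /A !mulmxA mulmxK.
  have E'E : E' = F *m E *m invmx F by rewrite /E' -/A' A'E Sign_conj.
  have := conj_principal_sqrt F_unit ES; rewrite -/A => FS.
  have -> : S' = F *m S *m invmx F.
    apply: (principal_sqrt_unique ES'); move: FS.
    by rewrite -/A' E'E A'E !mulmxA mulmxKV.
  by rewrite /W !mulmxA mulmxKV// mulmxK.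
have EH : dagger E *m H = H *m E by apply/adj_eq_mul.
(* Here [W^[H] W = S^-1 A S^-1], and [A = E S S] with [E] commuting with [S] reduces this to [E]. *)
have WHW : dagger W *m H *m W = H *m E.
  have -> : dagger W *m H = H *m adj H W by apply/adj_eq_mul.
  rewrite -mulmxA; congr (H *m _); rewrite /W adjM// adjV// Sa.
  have AE : A = E *m S *m S by rewrite -mulmxA SS mulmxA EE mul1mx.
  rewrite mulmxA -(mulmxA (invmx S) (adj H F) F) -/A AE ESC.
  by rewrite mulmxA mulmxK// mulKmx.
clearbody W.
have [X [XX XHX XE]] := exists_neutral_involution H_unit H_sa WU EE EH WHW.
have XN := neutral_involutionP H_unit H_sa EE EH XX XHX XE.
pose L := W *m X.
have LX : L *m X = W by rewrite /L -mulmxA XX mulmx1.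
have LU : H_unitary H L.
  suff LL : adj H L *m L = 1%:M by split=> //; exact: mulmx1C.
  have LHL : dagger L *m H *m L = H.
    transitivity (dagger X *m (dagger W *m H *m W) *m X).
      by rewrite /L daggerM !mulmxA.
    by rewrite WHW -XHX !mulmxA -daggerM XX dagger1 mul1mx -mulmxA XX mulmx1.
  by rewrite /adj -!mulmxA [dagger L *m _]mulmxA LHL mulVmx.
pose X' := L *m X *m adj H L.
have XN' : H_normal_neutral_involutory H X' by exact: neutral_involution_conj.
have XL' : X' *m L = W by rewrite /X' -mulmxA LU.1 mulmx1.
(* A single [L] suffices: [L X] and [X' L] are both [W], which stands to the left of [S] or to the
   right of [S']. *)
exists L, L, L, L, X, X, X', X'; do !split=> //.
- by rewrite LX.
- by rewrite -mulmxA LX.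
- by rewrite -mulmxA XL'.
- by rewrite XL'.
- by rewrite LX.
- by rewrite LX.
Qed.
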